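(* The expectation monad $\mathsf E$ on the category $\mathbf{Set}$ of sets is a linear exponential monad with respect to the convex monoidal structure $(\star,0)$; that is, $\mathsf E$ admits a symmetric opmonoidal structure with respect to $(\star,0)$ for which the lifted symmetric monoidal structure on the category of $\mathsf E$-algebras is given by finite coproducts.
   Context: The expectation monad $\mathsf E=(\mathcal E,\eta,\mu)$ on $\mathbf{Set}$: $\mathcal EX$ is the set of functions $\omega\colon\mathcal P(X)\to[0,1]$ on the powerset of $X$ such that $\omega(X)=1$ and $\omega(A\cup B)=\omega(A)+\omega(B)$ for disjoint $A,B\subseteq X$ (normalised finitely additive measures). On maps, $(\mathcal Ef)(\omega)(B)=\omega(f^{-1}(B))$; $\eta_X(x)(A)=1$ if $x\in A$ and $0$ otherwise; and $\mu_X(\omega)(A)=\int_{\tau\in\mathcal EX}\tau(A)\,\mathrm d\omega$, the integral of the bounded function $\tau\mapsto\tau(A)$ against the finitely additive measure $\omega$ on $\mathcal EX$. The convex monoidal structure on $\mathbf{Set}$ has unit the empty set $0$ and tensor $A\star B=A+\bigl((0,1)\times A\times B\bigr)+B$, with $f\star g=f+\bigl((0,1)\times f\times g\bigr)+g$. The unit constraints are the evident ones $A\star0\cong A\cong0\star A$. Writing $r^*=1-r$, the associativity constraint $(A\star B)\star C\to A\star(B\star C)$ sends $(r,(s,a,b),c)$, for $r,s\in(0,1)$, to $\bigl(rs,a,(\tfrac{rs^*}{(rs)^*},b,c)\bigr)$, and is the evident identity on the remaining summands $A$, $B$, $C$, $(0,1)\times A\times B$, $(0,1)\times A\times C$, $(0,1)\times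 B\times C$. The symmetry $A\star B\to B\star A$ sends $(r,a,b)$ to $(r^*,b,a)$ and is the evident identity on the summands $A$ and $B$. A symmetric opmonoidal structure on a monad $\mathsf T=(T,\eta,\mu)$ on a symmetric monoidal category $(\mathcal C,\otimes,I)$ consists of a map $\upsilon_I\colon TI\to I$ and natural maps $\upsilon_{XY}\colon T(X\otimes Y)\to TX\otimes TY$ making $T$ a symmetric opmonoidal (colax monoidal) functor and $\eta,\mu$ opmonoidal transformations. It lifts the symmetric monoidal structure of $\mathcal C$ to the category $\mathcal C^{\mathsf T}$ of Eilenberg--Moore algebras: $(X,x)\otimes(Y,y)=(X\otimes Y,(x\otimes y)\circ\upsilon_{XY})$, with unit $(I,\upsilon_I)$ and constraints those of $\mathcal C$. (Such structures correspond bijectively to symmetric monoidal structures on $\mathcal C^{\mathsf T}$ for which the forgetful functor is strict symmetric monoidal.) A linear exponential monad is a symmetric opmonoidal monad for which $(I,\upsilon_I)$ is initial in $\mathcal C^{\mathsf T}$ and, for all algebras $(X,x),(Y,y)$, the cospan $(X,x)\cong(X,x)\otimes(I,\upsilon_I)\xrightarrow{1\otimes !}(X,x)\otimes(Y,y)\xleftarrow{!\otimes 1}(I,\upsilon_I)\otimes(Y,y)\cong(Y,y)$ is a coproduct in $\mathcal C^{\mathsf T}$, where $!$ denotes the unique maps out of the initial algebra. *)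

(* Defs.v *)
From mathcomp Require Import all_boot all_order all_algebra.
From mathcomp Require Import boolp classical_sets reals.
From mathcomp Require Import ring lra.

Set Implicit Arguments.
Unset Strict Implicit.
Unset Printing Implicit Defensive.

Declare Scope cat_scope.
Delimit Scope cat_scope with cat.
Local Open Scope cat_scope.

Record category := Category {
  obj :> Type;
  hom : obj -> obj -> Type;
  idm : forall A, hom A A;
  comp : forall A B C, hom B C -> hom A B -> hom A C;
  comp1m : forall A B (f : hom A B), comp (idm B) f = f;
  compm1 : forall A B (f : hom A B), comp f (idm A) = f;
  compA : forall A B C D (h : hom C D) (g : hom B C) (f : hom A B),
    comp h (comp g f) = comp (comp h g) f }.

Arguments idm {c} A.
Notation "1_ A" := (idm A) (at level 8, A at level 2, format "1_ A") : cat_scope.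
Notation "g ∘ f" := (comp g f) (at level 40, left associativity) : cat_scope.

Record functor (C D : category) := Functor {
  fobj :> C -> D;
  fmap : forall A B, hom A B -> hom (fobj A) (fobj B);
  fmap1 : forall A, fmap 1_A = 1_(fobj A);
  fmap_comp : forall A B E (g : hom B E) (f : hom A B),
    fmap (g ∘ f) = fmap g ∘ fmap f }.

Arguments fmap {C D} _ [A B].

Record monad (C : category) := Monad {
  mfun :> functor C C;
  eta : forall A, hom A (mfun A);
  mu : forall A, hom (mfun (mfun A)) (mfun A);
  eta_nat : forall A B (f : hom A B), fmap mfun f ∘ eta A = eta B ∘ f;
  mu_nat : forall A B (f : hom A B),
    fmap mfun f ∘ mu A = mu B ∘ fmap mfun (fmap mfun f);
  mu_eta : forall A, mu A ∘ eta (mfun A) = 1_(mfun A);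
  mu_map_eta : forall A, mu A ∘ fmap mfun (eta A) = 1_(mfun A);
  mu_mu : forall A, mu A ∘ mu (mfun A) = mu A ∘ fmap mfun (mu A) }.

Arguments eta {C} _ A.
Arguments mu {C} _ A.

Record sym_mon_cat := SymMonCat {
  smc_cat :> category;
  unit_obj : smc_cat;
  tens : smc_cat -> smc_cat -> smc_cat;
  tmap : forall A A' B B', hom A A' -> hom B B' -> hom (tens A B) (tens A' B');
  assoc : forall A B C, hom (tens (tens A B) C) (tens A (tens B C));
  assocV : forall A B C, hom (tens A (tens B C)) (tens (tens A B) C);
  lunit : forall A, hom (tens unit_obj A) A;
  lunitV : forall A, hom A (tens unit_obj A);
  runit : forall A, hom (tens A unit_obj) A;
  runitV : forall A, hom A (tens A unit_obj);
  swap : forall A B, hom (tens A B) (tens B A);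
  tmap1 : forall A B, tmap 1_A 1_B = 1_(tens A B);
  tmap_comp : forall A A' A'' B B' B'' (f' : hom A' A'') (f : hom A A')
      (g' : hom B' B'') (g : hom B B'),
    tmap (f' ∘ f) (g' ∘ g) = tmap f' g' ∘ tmap f g;
  assoc_nat : forall A A' B B' C C' (f : hom A A') (g : hom B B') (h : hom C C'),
    assoc A' B' C' ∘ tmap (tmap f g) h = tmap f (tmap g h) ∘ assoc A B C;
  lunit_nat : forall A A' (f : hom A A'),
    lunit A' ∘ tmap 1_unit_obj f = f ∘ lunit A;
  runit_nat : forall A A' (f : hom A A'),
    runit A' ∘ tmap f 1_unit_obj = f ∘ runit A;
  swap_nat : forall A A' B B' (f : hom A A') (g : hom B B'),
    swap A' B' ∘ tmap f g = tmap g f ∘ swap A B;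
  assocK : forall A B C, assocV A B C ∘ assoc A B C = 1_(tens (tens A B) C);
  assocVK : forall A B C, assoc A B C ∘ assocV A B C = 1_(tens A (tens B C));
  lunitK : forall A, lunitV A ∘ lunit A = 1_(tens unit_obj A);
  lunitVK : forall A, lunit A ∘ lunitV A = 1_A;
  runitK : forall A, runitV A ∘ runit A = 1_(tens A unit_obj);
  runitVK : forall A, runit A ∘ runitV A = 1_A;
  swapK : forall A B, swap B A ∘ swap A B = 1_(tens A B);
  triangle : forall A B,
    tmap 1_A (lunit B) ∘ assoc A unit_obj B = tmap (runit A) 1_B;
  pentagon : forall A B C D,
    tmap 1_A (assoc B C D) ∘ assoc A (tens B C) D ∘ tmap (assoc A B C) 1_D
    = assoc A B (tens C D) ∘ assoc (tens A B) C D;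
  hexagon : forall A B C,
    assoc B C A ∘ swap A (tens B C) ∘ assoc A B C
    = tmap 1_B (swap A C) ∘ assoc B A C ∘ tmap (swap A B) 1_C }.

Arguments unit_obj {s}.
Arguments assoc {s} A B C.
Arguments assocV {s} A B C.
Arguments lunit {s} A.
Arguments lunitV {s} A.
Arguments runit {s} A.
Arguments runitV {s} A.
Arguments swap {s} A B.
Notation "A ⊗ B" := (tens A B) (at level 40, left associativity) : cat_scope.
Notation "f ⊠ g" := (tmap f g) (at level 40, left associativity) : cat_scope.

(* The functor underlying the monad is colax, and eta and mu are opmonoidal. *)
Record sym_opmonoidal (C : sym_mon_cat) (T : monad C) := SymOpmonoidal {
  upsI : hom (T unit_obj) unit_obj;
  ups : forall X Y : C, hom (T (X ⊗ Y)) (T X ⊗ T Y);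
  ups_nat : forall (X X' Y Y' : C) (f : hom X X') (g : hom Y Y'),
    ups X' Y' ∘ fmap T (f ⊠ g) = (fmap T f ⊠ fmap T g) ∘ ups X Y;
  ups_assoc : forall X Y Z : C,
    assoc (T X) (T Y) (T Z) ∘ (ups X Y ⊠ 1_(T Z)) ∘ ups (X ⊗ Y) Z
    = (1_(T X) ⊠ ups Y Z) ∘ ups X (Y ⊗ Z) ∘ fmap T (assoc X Y Z);
  ups_lunit : forall X : C,
    lunit (T X) ∘ (upsI ⊠ 1_(T X)) ∘ ups unit_obj X = fmap T (lunit X);
  ups_runit : forall X : C,
    runit (T X) ∘ (1_(T X) ⊠ upsI) ∘ ups X unit_obj = fmap T (runit X);
  ups_swap : forall X Y : C,
    swap (T X) (T Y) ∘ ups X Y = ups Y X ∘ fmap T (swap X Y);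
  ups_eta : forall X Y : C, ups X Y ∘ eta T (X ⊗ Y) = eta T X ⊠ eta T Y;
  upsI_eta : upsI ∘ eta T unit_obj = 1_unit_obj;
  ups_mu : forall X Y : C,
    ups X Y ∘ mu T (X ⊗ Y)
    = (mu T X ⊠ mu T Y) ∘ ups (T X) (T Y) ∘ fmap T (ups X Y);
  upsI_mu : upsI ∘ mu T unit_obj = upsI ∘ fmap T upsI }.

Record algebra (C : category) (T : monad C) := Algebra {
  carrier :> C;
  act : hom (T carrier) carrier;
  act_eta : act ∘ eta T carrier = 1_carrier;
  act_mu : act ∘ mu T carrier = act ∘ fmap T act }.

Arguments act {C T} _.

Record alg_hom (C : category) (T : monad C) (X Y : algebra T) := AlgHom {
  alg_fun : hom X Y;
  alg_funP : alg_fun ∘ act X = act Y ∘ fmap T alg_fun }.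

Section EM.
Context (C : category) (T : monad C).

Lemma alg_hom_eq (X Y : algebra T) (f g : alg_hom X Y) :
  alg_fun f = alg_fun g -> f = g.
Proof.
case: f g => [f fP] [g gP] /= fg.
by case: _ / fg gP => gP; congr AlgHom; exact: Prop_irrelevance.
Qed.

Lemma alg_id_subproof (X : algebra T) :
  1_(carrier X) ∘ act X = act X ∘ fmap T 1_(carrier X).
Proof. by rewrite fmap1 comp1m compm1. Qed.

Lemma alg_comp_subproof (X Y Z : algebra T) (g : alg_hom Y Z) (f : alg_hom X Y) :
  (alg_fun g ∘ alg_fun f) ∘ act X = act Z ∘ fmap T (alg_fun g ∘ alg_fun f).
Proof. by rewrite fmap_comp compA -alg_funP -!compA -alg_funP. Qed.

Definition alg_id (X : algebra T) := AlgHom (alg_id_subproof X).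
Definition alg_comp (X Y Z : algebra T) (g : alg_hom Y Z) (f : alg_hom X Y) :=
  AlgHom (alg_comp_subproof g f).

Program Definition EM : category :=
  @Category (algebra T) (@alg_hom C T) alg_id alg_comp _ _ _.
Next Obligation. by apply: alg_hom_eq; rewrite /= comp1m. Qed.
Next Obligation. by apply: alg_hom_eq; rewrite /= compm1. Qed.
Next Obligation. by apply: alg_hom_eq; rewrite /= compA. Qed.

Lemma alg_inv_subproof (X Y : algebra T) (f : hom X Y) (g : hom Y X) :
  g ∘ f = 1_(carrier X) -> f ∘ g = 1_(carrier Y) ->
  f ∘ act X = act Y ∘ fmap T f -> g ∘ act Y = act X ∘ fmap T g.
Proof.
move=> gf fg fP.
rewrite -[LHS]compm1 -fmap1 -fg fmap_comp compA -(compA g) -fP !compA gf.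
by rewrite comp1m.
Qed.
End EM.

Section Lift.
Context (C : sym_mon_cat) (T : monad C) (U : sym_opmonoidal T).
Implicit Types X Y Z : algebra T.

Definition alg_unit : algebra T := Algebra (upsI_eta U) (upsI_mu U).

Lemma alg_tens_eta X Y :
  (act X ⊠ act Y) ∘ ups U X Y ∘ eta T (X ⊗ Y) = 1_(X ⊗ Y).
Proof. by rewrite -compA ups_eta -tmap_comp !act_eta tmap1. Qed.

Lemma alg_tens_mu X Y :
  (act X ⊠ act Y) ∘ ups U X Y ∘ mu T (X ⊗ Y)
  = (act X ⊠ act Y) ∘ ups U X Y ∘ fmap T ((act X ⊠ act Y) ∘ ups U X Y).
Proof.
rewrite -!compA ups_mu fmap_comp !compA -tmap_comp !act_mu tmap_comp.
by rewrite -(compA _ _ (fmap T (_ ⊠ _))) ups_nat !compA.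
Qed.

Definition alg_tens X Y : algebra T :=
  Algebra (alg_tens_eta X Y) (alg_tens_mu X Y).

Lemma alg_tmap_subproof X X' Y Y' (f : alg_hom X X') (g : alg_hom Y Y') :
  (alg_fun f ⊠ alg_fun g) ∘ act (alg_tens X Y)
  = act (alg_tens X' Y') ∘ fmap T (alg_fun f ⊠ alg_fun g).
Proof.
rewrite /= -compA ups_nat !compA -!tmap_comp.
by rewrite !alg_funP.
Qed.

Definition alg_tmap X X' Y Y' (f : alg_hom X X') (g : alg_hom Y Y') :
  alg_hom (alg_tens X Y) (alg_tens X' Y') :=
  @AlgHom _ _ (alg_tens X Y) (alg_tens X' Y') _ (alg_tmap_subproof f g).

Lemma alg_assoc_subproof X Y Z :
  assoc (X : C) Y Z ∘ act (alg_tens (alg_tens X Y) Z)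
  = act (alg_tens X (alg_tens Y Z)) ∘ fmap T (assoc (X : C) Y Z).
Proof.
rewrite /=.
have -> : ((act X ⊠ act Y) ∘ ups U X Y) ⊠ act Z
    = ((act X ⊠ act Y) ⊠ act Z) ∘ (ups U X Y ⊠ 1_(T (carrier Z))).
  by rewrite -tmap_comp compm1.
have -> : act X ⊠ ((act Y ⊠ act Z) ∘ ups U Y Z)
    = (act X ⊠ (act Y ⊠ act Z)) ∘ (1_(T (carrier X)) ⊠ ups U Y Z).
  by rewrite -tmap_comp compm1.
by rewrite !compA assoc_nat -!compA; congr (_ ∘ _); rewrite !compA ups_assoc.
Qed.

Definition alg_assoc X Y Z :
  alg_hom (alg_tens (alg_tens X Y) Z) (alg_tens X (alg_tens Y Z)) :=
  @AlgHom _ _ (alg_tens (alg_tens X Y) Z) (alg_tens X (alg_tens Y Z)) _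
    (alg_assoc_subproof X Y Z).
Definition alg_assocV X Y Z :
  alg_hom (alg_tens X (alg_tens Y Z)) (alg_tens (alg_tens X Y) Z) :=
  @AlgHom _ _ (alg_tens X (alg_tens Y Z)) (alg_tens (alg_tens X Y) Z) _
    (@alg_inv_subproof _ _ (alg_tens (alg_tens X Y) Z)
       (alg_tens X (alg_tens Y Z)) _ _
       (assocK _ _ _) (assocVK _ _ _) (alg_assoc_subproof X Y Z)).

Lemma alg_lunit_subproof X :
  lunit (X : C) ∘ act (alg_tens alg_unit X) = act X ∘ fmap T (lunit (X : C)).
Proof.
rewrite /=.
have -> : upsI U ⊠ act X
    = (1_unit_obj ⊠ act X) ∘ (upsI U ⊠ 1_(T (carrier X))).
  by rewrite -tmap_comp compm1 comp1m.
by rewrite !compA lunit_nat -(ups_lunit U) !compA.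
Qed.

Definition alg_lunit X : alg_hom (alg_tens alg_unit X) X :=
  @AlgHom _ _ (alg_tens alg_unit X) X _ (alg_lunit_subproof X).
Definition alg_lunitV X : alg_hom X (alg_tens alg_unit X) :=
  @AlgHom _ _ X (alg_tens alg_unit X) _
    (@alg_inv_subproof _ _ (alg_tens alg_unit X) X _ _
       (lunitK _) (lunitVK _) (alg_lunit_subproof X)).

Lemma alg_runit_subproof X :
  runit (X : C) ∘ act (alg_tens X alg_unit) = act X ∘ fmap T (runit (X : C)).
Proof.
rewrite /=.
have -> : act X ⊠ upsI U
    = (act X ⊠ 1_unit_obj) ∘ (1_(T (carrier X)) ⊠ upsI U).
  by rewrite -tmap_comp compm1 comp1m.
by rewrite !compA runit_nat -(ups_runit U) !compA.
Qed.

Definition alg_runit X : alg_hom (alg_tens X alg_unit) X :=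
  @AlgHom _ _ (alg_tens X alg_unit) X _ (alg_runit_subproof X).
Definition alg_runitV X : alg_hom X (alg_tens X alg_unit) :=
  @AlgHom _ _ X (alg_tens X alg_unit) _
    (@alg_inv_subproof _ _ (alg_tens X alg_unit) X _ _
       (runitK _) (runitVK _) (alg_runit_subproof X)).

Lemma alg_swap_subproof X Y :
  swap (X : C) Y ∘ act (alg_tens X Y)
  = act (alg_tens Y X) ∘ fmap T (swap (X : C) Y).
Proof. by rewrite /= compA swap_nat -!compA ups_swap. Qed.

Definition alg_swap X Y : alg_hom (alg_tens X Y) (alg_tens Y X) :=
  @AlgHom _ _ (alg_tens X Y) (alg_tens Y X) _ (alg_swap_subproof X Y).

Program Definition EM_smc : sym_mon_cat :=
  @SymMonCat (EM T) alg_unit alg_tens alg_tmap alg_assoc alg_assocV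
    alg_lunit alg_lunitV alg_runit alg_runitV alg_swap
    _ _ _ _ _ _ _ _ _ _ _ _ _ _ _ _.
Next Obligation. by apply: alg_hom_eq; exact: tmap1. Qed.
Next Obligation. by apply: alg_hom_eq; exact: tmap_comp. Qed.
Next Obligation. by apply: alg_hom_eq; exact: assoc_nat. Qed.
Next Obligation. by apply: alg_hom_eq; exact: lunit_nat. Qed.
Next Obligation. by apply: alg_hom_eq; exact: runit_nat. Qed.
Next Obligation. by apply: alg_hom_eq; exact: swap_nat. Qed.
Next Obligation. by apply: alg_hom_eq; exact: assocK. Qed.
Next Obligation. by apply: alg_hom_eq; exact: assocVK. Qed.
Next Obligation. by apply: alg_hom_eq; exact: lunitK. Qed.
Next Obligation. by apply: alg_hom_eq; exact: lunitVK. Qed.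
Next Obligation. by apply: alg_hom_eq; exact: runitK. Qed.
Next Obligation. by apply: alg_hom_eq; exact: runitVK. Qed.
Next Obligation. by apply: alg_hom_eq; exact: swapK. Qed.
Next Obligation. by apply: alg_hom_eq; exact: triangle. Qed.
Next Obligation. by apply: alg_hom_eq; exact: pentagon. Qed.
Next Obligation. by apply: alg_hom_eq; exact: hexagon. Qed.
End Lift.

Definition is_initial (C : category) (I : C) : Prop :=
  forall A : C, exists! f : hom I A, True.

Definition is_coproduct (C : category) (A B S : C)
    (i : hom A S) (j : hom B S) : Prop :=
  forall (Z : C) (f : hom A Z) (g : hom B Z),
  exists! h : hom S Z, h ∘ i = f /\ h ∘ j = g.

Definition from_initial (C : category) (I : C) (H : is_initial I) (A : C) :
  hom I A := projT1 (cid (H A)).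

Definition is_cocartesian (C : sym_mon_cat) : Prop :=
  exists H : is_initial (@unit_obj C),
  forall X Y : C,
    is_coproduct ((1_X ⊠ from_initial H Y) ∘ runitV X)
                 ((from_initial H X ⊠ 1_Y) ∘ lunitV Y).

Definition linear_exponential (C : sym_mon_cat) (T : monad C)
  (U : sym_opmonoidal T) : Prop := is_cocartesian (EM_smc U).

Import Order.TTheory GRing.Theory Num.Theory.
Local Open Scope ring_scope.

Program Definition Sets : category :=
  @Category Type (fun A B => A -> B) (fun A x => x)
    (fun A B C g f x => g (f x)) _ _ _.

Section Convex.
Context (R : realType).

Record ounit := OUnit { oval :> R; ounitP : 0 < oval < 1 }.

Lemma oval_inj (r s : ounit) : oval r = oval s -> r = s.
Proof.
case: r s => [r rP] [s sP] /= rs.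
by case: _ / rs sP => sP; congr OUnit; exact: Prop_irrelevance.
Qed.

Lemma ounit_gt0 (r : ounit) : 0 < oval r. Proof. by case/andP: (ounitP r). Qed.
Lemma ounit_lt1 (r : ounit) : oval r < 1. Proof. by case/andP: (ounitP r). Qed.

Lemma onem_subproof (r : ounit) : 0 < 1 - oval r < 1.
Proof. by have := ounit_gt0 r; have := ounit_lt1 r; lra. Qed.
Definition onem (r : ounit) : ounit := OUnit (onem_subproof r).

Lemma omul_subproof (r s : ounit) : 0 < oval r * oval s < 1.
Proof.
have := ounit_gt0 r; have := ounit_lt1 r.
by have := ounit_gt0 s; have := ounit_lt1 s; nra.
Qed.
Definition omul (r s : ounit) : ounit := OUnit (omul_subproof r s).

Lemma oquot_subproof (r s : ounit) :
  0 < oval r * oval (onem s) / oval (onem (omul r s)) < 1.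
Proof.
have r0 := ounit_gt0 r; have r1 := ounit_lt1 r.
have s0 := ounit_gt0 s; have s1 := ounit_lt1 s.
have m0 := ounit_gt0 (onem (omul r s)).
rewrite divr_gt0 ?mulr_gt0 ?ounit_gt0 //= ltr_pdivrMr // mul1r /=.
nra.
Qed.
(* r s^* / (r s)^* where t^* = 1 - t *)
Definition oquot (r s : ounit) : ounit := OUnit (oquot_subproof r s).

Definition star (A B : Type) : Type := (A + ounit * A * B + B)%type.

Definition starL A B (a : A) : star A B := inl (inl a).
Definition starM A B (r : ounit) (a : A) (b : B) : star A B :=
  inl (inr (r, a, b)).
Definition starR A B (b : B) : star A B := inr b.

Definition star_map A A' B B' (f : A -> A') (g : B -> B')
    (x : star A B) : star A' B' :=
  match x with
  | inl (inl a) => starL _ (f a)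
  | inl (inr (r, a, b)) => starM r (f a) (g b)
  | inr b => starR _ (g b)
  end.

Definition star_assoc A B C (x : star (star A B) C) : star A (star B C) :=
  match x with
  | inl (inl (inl (inl a))) => starL _ a
  | inl (inl (inl (inr (s, a, b)))) => starM s a (starL _ b)
  | inl (inl (inr b)) => starR _ (starL _ b)
  | inl (inr (r, inl (inl a), c)) => starM r a (starR _ c)
  | inl (inr (r, inl (inr (s, a, b)), c)) =>
      starM (omul r s) a (starM (oquot r s) b c)
  | inl (inr (r, inr b, c)) => starR _ (starM r b c)
  | inr c => starR _ (starR _ c)
  end.

Definition star_swap A B (x : star A B) : star B A :=
  match x with
  | inl (inl a) => starR _ a
  | inl (inr (r, a, b)) => starM (onem r) b a
  | inr b => starL _ b
  end.

(* The inverse of the associator, transported along the symmetry. *)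
Definition star_assocV A B C (x : star A (star B C)) : star (star A B) C :=
  star_swap (star_map id (@star_swap B A)
    (star_assoc (star_swap (star_map id (@star_swap B C) x)))).

Definition star_lunit A (x : star void A) : A :=
  match x with
  | inl (inl e) => match e with end
  | inl (inr (_, e, _)) => match e with end
  | inr a => a
  end.

Definition star_runit A (x : star A void) : A :=
  match x with
  | inl (inl a) => a
  | inl (inr (_, _, e)) => match e with end
  | inr e => match e with end
  end.

Lemma starM_eq A B (r r' : ounit) (x x' : A) (y y' : B) :
  oval r = oval r' -> x = x' -> y = y' -> starM r x y = starM r' x' y'.
Proof. by move=> /oval_inj -> -> ->. Qed.

Lemma starL_eq A B (x x' : A) : x = x' -> starL B x = starL B x'.
Proof. by move=> ->. Qed.

Lemma starR_eq A B (y y' : B) : y = y' -> starR A y = starR A y'.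
Proof. by move=> ->. Qed.

Ltac ounit_tac :=
  rewrite /=;
  repeat match goal with
  | r : ounit |- _ =>
      let h0 := fresh in let h1 := fresh in
      have h0 := ounit_gt0 r; have h1 := ounit_lt1 r; move: (oval r) h0 h1;
      clear r; move=> r h0 h1
  end;
  field; try done;
  repeat (apply/andP; split); apply: lt0r_neq0;
  first [nra | rewrite subr_gt0; repeat first
    [assumption | apply: mulr_ilt1 | apply: mulr_ge0 | apply: ltW]].

Ltac star_tac :=
  first [reflexivity
        | refine (starL_eq _ _); star_tac
        | refine (starR_eq _ _); star_tac
        | refine (starM_eq _ _ _); [by ounit_tac|star_tac|star_tac]].

Lemma star_swapK A B (x : star A B) : star_swap (star_swap x) = x.
Proof. by case: x => [[a|[[r a] b]]|b] //=; star_tac. Qed.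

Lemma star_assocK A B C (x : star (star A B) C) :
  star_assocV (star_assoc x) = x.
Proof.
case: x => [[[[a|[[s a] b]]|b]|[[r [[a|[[s a] b]]|b]] c]]|c];
  rewrite /star_assocV /=.
all: star_tac.
Qed.

Lemma star_assocVK A B C (x : star A (star B C)) :
  star_assoc (star_assocV x) = x.
Proof.
case: x => [[a|[[r a] [[b|[[s b] c]]|c]]]|[[b|[[s b] c]]|c]];
  rewrite /star_assocV /=.
all: star_tac.
Qed.

Lemma star_pentagon A B C D (x : star (star (star A B) C) D) :
  star_map id (@star_assoc B C D)
    (star_assoc (star_map (@star_assoc A B C) id x))
  = star_assoc (star_assoc x).
Proof.
case: x => [[[[[[a|[[t a] b]]|b]|[[s [[a|[[t a] b]]|b]] c]]|c]
  |[[r [[[[a|[[t a] b]]|b]|[[s [[a|[[t a] b]]|b]] c]]|c]] d]]|d]; rewrite /=.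
all: star_tac.
Qed.

Lemma star_hexagon A B C (x : star (star A B) C) :
  star_assoc (star_swap (star_assoc x))
  = star_map id (@star_swap A C)
      (star_assoc (star_map (@star_swap A B) id x)).
Proof.
case: x => [[[[a|[[s a] b]]|b]|[[r [[a|[[s a] b]]|b]] c]]|c];
  rewrite /star_assocV /=.
all: star_tac.
Qed.

Program Definition convex_smc : sym_mon_cat :=
  @SymMonCat Sets void star star_map star_assoc star_assocV
    star_lunit (@starR void) star_runit (fun A => @starL A void) star_swap
    _ _ _ _ _ _ _ _ _ _ _ _ _ _ _ _.
Next Obligation. by apply: funext => -[[a|[[r a] b]]|b]. Qed.
Next Obligation. by apply: funext => -[[a|[[r a] b]]|b]. Qed.
Next Obligation.
by apply: funext => -[[[[a|[[s a] b]]|b]|[[r [[a|[[s a] b]]|b]] c]]|c].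
Qed.
Next Obligation. by apply: funext => -[[[]|[[r []] b]]|b]. Qed.
Next Obligation. by apply: funext => -[[a|[[r a] []]]|[]]. Qed.
Next Obligation. by apply: funext => -[[a|[[r a] b]]|b]. Qed.
Next Obligation. by apply: funext => x; exact: star_assocK. Qed.
Next Obligation. by apply: funext => x; exact: star_assocVK. Qed.
Next Obligation. by apply: funext => -[[[]|[[r []] b]]|b]. Qed.
Next Obligation. by apply: funext => -[[a|[[r a] []]]|[]]. Qed.
Next Obligation. by apply: funext => x; exact: star_swapK. Qed.
Next Obligation.
apply: funext.
by move=> -[[[[a|[[s a] []]]|[]]|[[r [[a|[[s a] []]]|[]]] c]]|c].
Qed.
Next Obligation. by apply: funext => x; exact: star_pentagon. Qed.
Next Obligation. by apply: funext => x; exact: star_hexagon. Qed.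
End Convex.

Local Open Scope classical_set_scope.

Section Expectation.
Context (R : realType).

Record expect (X : Type) := Expect {
  mass :> set X -> R;
  mass01 : forall A, 0 <= mass A <= 1;
  massT : mass setT = 1;
  massU : forall A B, A `&` B = set0 -> mass (A `|` B) = mass A + mass B }.

Lemma expect_eq X (w v : expect X) : (forall A, w A = v A) -> w = v.
Proof.
move=> /funext; case: w v => [w w1 w2 w3] [v v1 v2 v3] /= wv.
by case: _ / wv v1 v2 v3 => *; congr Expect; exact: Prop_irrelevance.
Qed.

(* Every subset is measurable and [f] is bounded, so the integral against a
   finitely additive mass is the supremum of the lower sums of [f] over finite
   partitions, given as the fibres of maps [p : X -> 'I_n]; empty fibres have
   mass 0, so the value of [c] there is irrelevant. *)
Definition lower_sums X (w : expect X) (f : X -> R) : set R :=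
  [set s | exists n (p : X -> 'I_n) (c : 'I_n -> R),
    (forall x, c (p x) <= f x) /\ s = \sum_(i < n) c i * w (p @^-1` [set i])].

Definition fa_integral X (w : expect X) (f : X -> R) : R :=
  sup (lower_sums w f).

Definition bdd X (f : X -> R) := exists M, forall x, `|f x| <= M.

Lemma mass_ge0 X (w : expect X) A : 0 <= w A.
Proof. by case/andP: (mass01 w A). Qed.

Section Integral.
Context (X : Type) (w : expect X).

Lemma mass0 : w set0 = 0.
Proof.
have := @massU _ w set0 set0 (set0I _); rewrite set0U => h.
by apply: (addrI (w set0)); rewrite -h addr0.
Qed.

Lemma mass_fin (I : finType) (q : X -> I) (P : pred I) :
  w [set x | P (q x)] = \sum_(i | P i) w (q @^-1` [set i]).
Proof.
have -> : [set x | P (q x)] = [set x | q x \in [seq i <- index_enum I | P i]].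
  by apply/seteqP; split=> x /=; rewrite mem_filter mem_index_enum andbT.
rewrite -big_filter.
have := filter_uniq P (index_enum_uniq I).
elim: [seq i <- _ | _] => [_|i s IH /= /andP[nis us]].
  rewrite big_nil -mass0; congr (w _).
  by apply/seteqP; split=> x.
rewrite big_cons -IH // -massU.
  congr (w _); apply/seteqP; split=> x /=; rewrite in_cons.
    by move=> /orP[/eqP|]; [left|right].
  by move=> [->|->]; rewrite ?eqxx ?orbT.
by apply/seteqP; split=> x //= -[-> si]; rewrite si in nis.
Qed.

Definition ssum (I : finType) (q : X -> I) (c : I -> R) : R :=
  \sum_i c i * w (q @^-1` [set i]).

Lemma ssum_refine (I J : finType) (q : X -> I) (h : I -> J) (c : J -> R) :
  ssum (fun x => h (q x)) c = ssum q (fun i => c (h i)).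
Proof.
rewrite /ssum [RHS](partition_big h xpredT) //=; apply: eq_bigr => j _.
under eq_bigr => i /eqP -> do [].
rewrite -mulr_sumr; congr (_ * _).
rewrite -(mass_fin q (fun i => h i == j)); congr (w _).
by apply/seteqP; split=> x /= /eqP.
Qed.

Lemma ssum_mono (I J : finType) (q : X -> I) (r : X -> J) c d :
  (forall x, c (q x) <= d (r x)) -> ssum q c <= ssum r d.
Proof.
move=> cd.
have -> : ssum q c = ssum (fun x => (q x, r x)) (fun ij => c ij.1).
  exact: (ssum_refine (fun x => (q x, r x)) fst c).
have -> : ssum r d = ssum (fun x => (q x, r x)) (fun ij => d ij.2).
  exact: (ssum_refine (fun x => (q x, r x)) snd d).
apply: ler_sum => -[i j] _ /=.
have [[x [xi xj]]|/forallNP ne] :=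
    pselect (exists x, q x = i /\ r x = j).
  by apply: ler_wpM2r; [exact: mass_ge0|rewrite -xi -xj].
suff -> : (fun x => (q x, r x)) @^-1` [set (i, j)] = set0 by rewrite mass0 !mulr0.
by apply/seteqP; split=> x //= -[xi xj]; apply: (ne x).
Qed.

Lemma ssumD (I : finType) (q : X -> I) c d :
  ssum q (fun i => c i + d i) = ssum q c + ssum q d.
Proof. by rewrite -big_split; apply: eq_bigr => i _; rewrite mulrDl. Qed.

Lemma ssumZ (I : finType) (q : X -> I) a c :
  ssum q (fun i => a * c i) = a * ssum q c.
Proof. by rewrite mulr_sumr; apply: eq_bigr => i _; rewrite mulrA. Qed.

Lemma ssum_cst (I : finType) (q : X -> I) a : ssum q (fun=> a) = a.
Proof.
rewrite /ssum -mulr_sumr -(mass_fin q xpredT).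
by rewrite (_ : [set x | _] = setT) ?massT ?mulr1 //; apply/seteqP.
Qed.

Lemma lower_sums_fin (I : finType) (q : X -> I) c f :
  (forall x, c (q x) <= f x) -> lower_sums w f (ssum q c).
Proof.
move=> cf; exists #|I|, (fun x => enum_rank (q x)), (fun i => c (enum_val i)).
split; first by move=> x; rewrite enum_rankK.
have := ssum_refine q enum_rank (fun i => c (enum_val i)).
rewrite /ssum => ->; apply: eq_bigr => i _; by rewrite enum_rankK.
Qed.

Lemma lower_sums_ub (I : finType) (q : X -> I) c f :
  (forall x, f x <= c (q x)) -> ubound (lower_sums w f) (ssum q c).
Proof.
move=> fc _ [n [p [d [df ->]]]].
by apply: ssum_mono => x; apply: le_trans (df x) (fc x).
Qed.

Lemma lower_sums_nonempty f : bdd f -> lower_sums w f !=set0.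
Proof.
move=> [M fM]; exists (ssum (fun=> tt) (fun=> - M)).
by apply: lower_sums_fin => x; have := fM x; rewrite ler_norml => /andP[].
Qed.

Lemma lower_sums_has_ubound f : bdd f -> has_ubound (lower_sums w f).
Proof.
move=> [M fM]; exists (ssum (fun=> tt) (fun=> M)).
by apply: lower_sums_ub => x; have := fM x; rewrite ler_norml => /andP[].
Qed.

Lemma ssum_le_fa_integral (I : finType) (q : X -> I) c f : bdd f ->
  (forall x, c (q x) <= f x) -> ssum q c <= fa_integral w f.
Proof.
move=> bf cf; apply: ub_le_sup; first exact: lower_sums_has_ubound.
exact: lower_sums_fin.
Qed.

Lemma fa_integral_le_ssum (I : finType) (q : X -> I) c f : bdd f ->
  (forall x, f x <= c (q x)) -> fa_integral w f <= ssum q c.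
Proof.
move=> bf fc; apply: ge_sup; first exact: lower_sums_nonempty.
exact: lower_sums_ub.
Qed.

Lemma fa_integral_near (I : finType) (q : X -> I) c f e : bdd f ->
  (forall x, `|f x - c (q x)| <= e) -> `|fa_integral w f - ssum q c| <= e.
Proof.
move=> bf fc; rewrite ler_distl; apply/andP; split.
  have -> : ssum q c - e = ssum q (fun i => c i + - e).
    by rewrite ssumD ssum_cst.
  apply: ssum_le_fa_integral => // x; have := fc x.
  by rewrite ler_distl => /andP[].
have -> : ssum q c + e = ssum q (fun i => c i + e) by rewrite ssumD ssum_cst.
apply: fa_integral_le_ssum => // x; have := fc x.
by rewrite ler_distl => /andP[].
Qed.

Lemma bdd_fin (I : finType) (q : X -> I) (c : I -> R) :
  bdd (fun x => c (q x)).
Proof.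
exists (\sum_i `|c i|) => x; rewrite (bigD1 (q x)) //= lerDl.
exact: sumr_ge0.
Qed.

Lemma fa_integral_simple (I : finType) (q : X -> I) c :
  fa_integral w (fun x => c (q x)) = ssum q c.
Proof.
apply/eqP; rewrite -subr_eq0 -normr_le0.
apply: fa_integral_near; first exact: bdd_fin.
by move=> x; rewrite subrr normr0.
Qed.

Lemma simple_approx f e : bdd f -> 0 < e ->
  exists n (q : X -> 'I_n) (c : 'I_n -> R), forall x, `|f x - c (q x)| <= e.
Proof.
move=> [M fM] e0.
pose k x := Num.truncn ((f x + M) / e).
have fM0 x : 0 <= (f x + M) / e.
  by have := fM x; rewrite ler_norml => /andP[? _]; rewrite divr_ge0 //; lra.
have kN x : (k x < (Num.truncn ((M + M) / e)).+1)%N.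
  rewrite ltnS; apply: le_truncn; rewrite ler_pM2r ?invr_gt0 // lerD2r.
  by have := fM x; rewrite ler_norml => /andP[].
exists _, (fun x => Ordinal (kN x)), (fun i => i%:R * e - M) => x /=.
have /andP[] := truncn_itv (fM0 x).
rewrite -/(k x) ler_pdivlMr // ltr_pdivrMr // -natr1 => h1 h2.
by rewrite ler_norml; apply/andP; split; lra.
Qed.

Lemma bdd_near f (g : X -> R) e : bdd g ->
  (forall x, `|f x - g x| <= e) -> bdd f.
Proof.
move=> [M gM] fg; exists (e + M) => x.
by rewrite -(subrK (g x) (f x)) (le_trans (ler_normD _ _)) // lerD.
Qed.

Lemma eq_of_near (x y K : R) : 0 < K ->
  (forall e, 0 < e -> `|x - y| <= K * e) -> x = y.
Proof.
move=> K0 h; apply/eqP; rewrite -subr_eq0 -normr_le0.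
apply/ler_addgt0Pr => e e0; rewrite add0r.
by have := h (e / K) (divr_gt0 e0 K0); rewrite mulrCA divff ?gt_eqF // mulr1.
Qed.

Lemma bddD (f g : X -> R) :
  bdd f -> bdd g -> bdd (fun x => f x + g x).
Proof.
move=> [M fM] [N gN]; exists (M + N) => x.
by rewrite (le_trans (ler_normD _ _)) // lerD.
Qed.

Lemma bddZ a (f : X -> R) : bdd f -> bdd (fun x => a * f x).
Proof. by move=> [M fM]; exists (`|a| * M) => x; rewrite normrM ler_wpM2l. Qed.

Lemma fa_integralD (f g : X -> R) : bdd f -> bdd g ->
  fa_integral w (fun x => f x + g x) = fa_integral w f + fa_integral w g.
Proof.
move=> bf bg; apply: (@eq_of_near _ _ 4) => // e e0.
have [n [p [c pc]]] := simple_approx bf e0.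
have [m [q [d qd]]] := simple_approx bg e0.
have := fa_integral_near bf pc; have := fa_integral_near bg qd.
have : `|fa_integral w (fun x => f x + g x)
    - ssum (fun x => (p x, q x)) (fun ij => c ij.1 + d ij.2)| <= 2 * e.
  apply: fa_integral_near; first exact: bddD.
  by move=> x /=; have := pc x; have := qd x; rewrite !ler_norml; lra.
rewrite ssumD -(ssum_refine _ fst) -(ssum_refine _ snd) /=.
by rewrite !ler_norml; lra.
Qed.

Lemma fa_integralZ a (f : X -> R) : bdd f ->
  fa_integral w (fun x => a * f x) = a * fa_integral w f.
Proof.
move=> bf; apply: (@eq_of_near _ _ (2 * `|a| + 1)).
  by have := normr_ge0 a; lra.
move=> e e0; have [n [p [c pc]]] := simple_approx bf e0.
have h1 : `|a * fa_integral w f - a * ssum p c| <= `|a| * e.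
  by rewrite -mulrBr normrM ler_wpM2l //; exact: fa_integral_near.
have : `|fa_integral w (fun x => a * f x) - ssum p (fun i => a * c i)| <= `|a| * e.
  apply: fa_integral_near; first exact: bddZ.
  by move=> x; rewrite -mulrBr normrM ler_wpM2l.
rewrite ssumZ; move: h1; rewrite !ler_norml mulrDl mul1r -mulrA; lra.
Qed.

Lemma fa_integral_mono (f g : X -> R) : bdd f -> bdd g ->
  (forall x, f x <= g x) -> fa_integral w f <= fa_integral w g.
Proof.
move=> bf bg fg; apply: ge_sup; first exact: lower_sums_nonempty.
move=> _ [n [p [c [cf ->]]]]; apply: (ssum_le_fa_integral (q := p)) => // x.
exact: le_trans (cf x) (fg x).
Qed.

Lemma bdd_cst (a : R) : bdd (fun _ : X => a).
Proof. by exists `|a|. Qed.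

Lemma fa_integral_cst a : fa_integral w (fun=> a) = a.
Proof. by rewrite (fa_integral_simple (fun=> tt) (fun=> a)) ssum_cst. Qed.

Lemma fa_integral_norm f M : (forall x, `|f x| <= M) -> `|fa_integral w f| <= M.
Proof.
move=> fM; have bf : bdd f by exists M.
rewrite ler_norml -{2}(fa_integral_cst M) -(fa_integral_cst (- M)).
by apply/andP; split; apply: fa_integral_mono => //; try exact: bdd_cst;
  move=> x; have := fM x; rewrite ler_norml => /andP[].
Qed.

Lemma fa_integral_sum (I : finType) (F : I -> X -> R) :
  (forall i, bdd (F i)) ->
  fa_integral w (fun x => \sum_i F i x) = \sum_i fa_integral w (F i).
Proof.
move=> bF.
suff : forall s : seq I, bdd (fun x => \sum_(i <- s) F i x) /\
    fa_integral w (fun x => \sum_(i <- s) F i x) = \sum_(i <- s) fa_integral w (F i).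
  by move=> /(_ (index_enum I)) [].
elim=> [|i s [bs IH]].
  have -> : (fun x => \sum_(i <- [::]) F i x) = (fun=> 0).
    by apply: funext => x; rewrite big_nil.
  by rewrite big_nil fa_integral_cst; split => //; exact: bdd_cst.
have -> : (fun x => \sum_(j <- i :: s) F j x)
    = (fun x => F i x + \sum_(j <- s) F j x).
  by apply: funext => x; rewrite big_cons.
by rewrite big_cons -IH fa_integralD //; split => //; exact: bddD.
Qed.

Lemma fa_integral_indic A : fa_integral w (fun x => (x \in A)%:R) = w A.
Proof.
rewrite (fa_integral_simple (fun x => x \in A) (fun b => b%:R)) /ssum.
rewrite big_bool /= mul1r mul0r addr0; congr (w _).
by apply/seteqP; split=> x; rewrite /preimage /= -[A x]in_setE.
Qed.
End Integral.

Lemma bdd_mass X (A : set X) : bdd (fun t : expect X => t A).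
Proof.
exists 1 => t; have /andP[? ?] := mass01 t A.
by rewrite ler_norml; apply/andP; split; lra.
Qed.

Lemma bdd_comp X Y (h : X -> Y) (f : Y -> R) :
  bdd f -> bdd (fun x => f (h x)).
Proof. by move=> [M fM]; exists M. Qed.

Program Definition emap X Y (f : X -> Y) (w : expect X) : expect Y :=
  @Expect Y (fun B => w (f @^-1` B)) _ _ _.
Next Obligation. exact: mass01. Qed.
Next Obligation. exact: massT. Qed.
Next Obligation.
by rewrite preimage_setU massU // -preimage_setI H preimage_set0.
Qed.

Program Definition eeta X (x : X) : expect X :=
  @Expect X (fun A => (x \in A)%:R) _ _ _.
Next Obligation. by case: (x \in A); rewrite ?lexx ?ler01. Qed.
Next Obligation. by rewrite in_setT. Qed.
Next Obligation.
rewrite in_setU; have : x \notin A `&` B by rewrite H in_set0.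
rewrite in_setI.
by case: (x \in A); case: (x \in B) => //= _; rewrite ?addr0 ?add0r.
Qed.

Program Definition emu X (W : expect (expect X)) : expect X :=
  @Expect X (fun A => fa_integral W (fun t : expect X => t A)) _ _ _.
Next Obligation.
have b := bdd_mass A.
apply/andP; split.
  rewrite -(fa_integral_cst W 0); apply: fa_integral_mono => //.
    exact: bdd_cst.
  by move=> t; case/andP: (mass01 t A).
rewrite -[leRHS](fa_integral_cst W 1); apply: fa_integral_mono => //.
  exact: bdd_cst.
by move=> t; case/andP: (mass01 t A).
Qed.
Next Obligation.
rewrite -[RHS](fa_integral_cst W); congr fa_integral.
by apply: funext => t; exact: massT.
Qed.
Next Obligation.
rewrite -fa_integralD; [|exact: bdd_mass|exact: bdd_mass].
by congr fa_integral; apply: funext => t; exact: massU.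
Qed.

Lemma fa_integral_emap X Y (h : X -> Y) (w : expect X) f : bdd f ->
  fa_integral (emap h w) f = fa_integral w (fun x => f (h x)).
Proof.
move=> bf; apply: (@eq_of_near _ _ 2) => // e e0.
have [n [p [c pc]]] := simple_approx bf e0.
have := fa_integral_near (emap h w) bf pc.
have : `|fa_integral w (fun x => f (h x)) - ssum w (fun x => p (h x)) c| <= e.
  by apply: fa_integral_near => //; exact: bdd_comp.
have -> : ssum w (fun x => p (h x)) c = ssum (emap h w) p c by [].
by rewrite !ler_norml; lra.
Qed.

Lemma fa_integral_eeta X (x : X) f : bdd f -> fa_integral (eeta x) f = f x.
Proof.
move=> bf; apply: (@eq_of_near _ _ 2) => // e e0.
have [n [p [c pc]]] := simple_approx bf e0.
have := fa_integral_near (eeta x) bf pc; have := pc x.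
suff -> : ssum (eeta x) p c = c (p x) by rewrite !ler_norml; lra.
rewrite /ssum (bigD1 (p x)) //= big1 ?addr0.
  by rewrite mem_set // mulr1.
move=> i ip; rewrite memNset ?mulr0 //= => xi; by rewrite xi eqxx in ip.
Qed.

Lemma fa_integral_emu X (W : expect (expect X)) f : bdd f ->
  fa_integral (emu W) f = fa_integral W (fun t => fa_integral t f).
Proof.
move=> bf; apply: (@eq_of_near _ _ 2) => // e e0.
have [n [p [c pc]]] := simple_approx bf e0.
have := fa_integral_near (emu W) bf pc.
have bI : bdd (fun t : expect X => fa_integral t f).
  by case: bf => M fM; exists M => t; exact: fa_integral_norm.
have bS : bdd (fun t : expect X => ssum t p c).
  exists (\sum_i `|c i|) => t.
  rewrite (le_trans (ler_norm_sum _ _ _)) //; apply: ler_sum => i _.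
  rewrite normrM ler_piMr //; have /andP[? ?] := mass01 t (p @^-1` [set i]).
  by rewrite ger0_norm.
have -> : ssum (emu W) p c = fa_integral W (fun t => ssum t p c).
  rewrite /ssum fa_integral_sum; last first.
    by move=> i; apply: bddZ; exact: bdd_mass.
  by apply: eq_bigr => i _; rewrite fa_integralZ //; exact: bdd_mass.
have : `|fa_integral W (fun t => fa_integral t f - ssum t p c)| <= e.
  by apply: fa_integral_norm => t; exact: fa_integral_near.
have -> : fa_integral W (fun t => fa_integral t f - ssum t p c)
    = fa_integral W (fun t => fa_integral t f) - fa_integral W (fun t => ssum t p c).
  rewrite -[- fa_integral _ _]mulN1r -fa_integralZ // -fa_integralD //; last first.
    exact: bddZ.
  by congr fa_integral; apply: funext => t; rewrite mulN1r.
by rewrite !ler_norml; lra.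
Qed.

Program Definition expect_functor : functor Sets Sets :=
  @Functor Sets Sets expect emap _ _.
Next Obligation. by apply: funext => w; exact: expect_eq. Qed.
Next Obligation. by apply: funext => w; exact: expect_eq. Qed.

Program Definition expectation_monad : monad Sets :=
  @Monad Sets expect_functor eeta emu _ _ _ _ _.
Next Obligation.
by apply: funext => x; apply: expect_eq.
Qed.
Next Obligation.
apply: funext => W; apply: expect_eq => D /=.
by rewrite fa_integral_emap //; exact: bdd_mass.
Qed.
Next Obligation.
apply: funext => w; apply: expect_eq => D /=.
by rewrite fa_integral_eeta //; exact: bdd_mass.
Qed.
Next Obligation.
apply: funext => w; apply: expect_eq => D /=.
by rewrite fa_integral_emap ?fa_integral_indic //; exact: bdd_mass.
Qed.
Next Obligation.
apply: funext => W; apply: expect_eq => D /=.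
by rewrite fa_integral_emap ?fa_integral_emu //; exact: bdd_mass.
Qed.
End Expectation.

(* Main.v *)
(** A pair of real functions [f] on [X], [g] on [Y] gives a function [mix f g]
    on [star X Y], sending (r,x,y) to r f(x) + (1-r) g(y).  Functions of the
    form [mix (integral of f) (integral of g)] separate the points of
    [star (EX) (EY)], so the opmonoidal structure map
    [esplit : E(X star Y) -> EX star EY] is characterised by
    mix (int f) (int g) (esplit w) = int (mix f g) dw; it exists because
    f |-> int (mix f 0) dw is a positive functional, hence a multiple of the
    integral against an element of [EX], and likewise for [Y].  Every coherence
    equation follows by testing against bounded functions.
    For algebra maps f : A -> C, g : B -> C, a point t of A star B determines a
    formal convex combination of f and g in [EC], and evaluating it in C gives
    the copairing.  It is unique because t is itself the value in A star B of
    its formal combination of the two injections. *)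

Require Import Defs.
From mathcomp Require Import all_boot all_order all_algebra.
From mathcomp Require Import boolp classical_sets reals.
From mathcomp Require Import ring lra.

Set Implicit Arguments.
Unset Strict Implicit.
Unset Printing Implicit Defensive.

Import Order.TTheory GRing.Theory Num.Theory.
Local Open Scope classical_set_scope.
Local Open Scope ring_scope.

(** * Positive functionals on bounded functions as integrals *)

Section Representation.
Context (R : realType) (X : Type).
Implicit Types (F : (X -> R) -> R) (f : X -> R).

Definition positive_functional F : Prop :=
  [/\ forall f g, bdd f -> bdd g -> F (fun x => f x + g x) = F f + F g,
      forall a f, bdd f -> F (fun x => a * f x) = a * F f &
      forall f g, bdd f -> bdd g -> (forall x, f x <= g x) -> F f <= F g].

Lemma bdd_indic (A : set X) : bdd (fun x => (x \in A)%:R : R).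
Proof. exact: (bdd_fin (fun x => x \in A) (fun b : bool => b%:R)). Qed.

Lemma positive_functional_cst F a :
  positive_functional F -> F (fun=> a) = a * F (fun=> 1).
Proof.
move=> [_ FZ _]; rewrite -FZ; last exact: bdd_cst.
by congr F; apply: funext => x; rewrite mulr1.
Qed.

Lemma positive_functional_sum F (I : finType) (h : I -> X -> R) :
  positive_functional F -> (forall i, bdd (h i)) ->
  F (fun x => \sum_i h i x) = \sum_i F (h i).
Proof.
move=> [FD FZ _] bh.
suff : forall s : seq I, bdd (fun x => \sum_(i <- s) h i x) /\
    F (fun x => \sum_(i <- s) h i x) = \sum_(i <- s) F (h i).
  by move=> /(_ (index_enum I)) [].
elim=> [|i s [bs IH]].
  (* Zero is written as a scalar multiple so that homogeneity alone gives [F 0 = 0]. *)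
  have -> : (fun x => \sum_(i <- [::]) h i x) = (fun=> 0 * 0).
    by apply: funext => x; rewrite big_nil mulr0.
  by rewrite FZ ?mul0r ?big_nil; [split => //|]; exact: bdd_cst.
have -> : (fun x => \sum_(j <- i :: s) h j x)
    = (fun x => h i x + \sum_(j <- s) h j x).
  by apply: funext => x; rewrite big_cons.
by rewrite big_cons -IH FD //; split => //; exact: bddD.
Qed.

(** By linearity [F] and the integral agree on simple functions. Monotonicity then squeezes [F f]
    between the values at a uniform simple approximation shifted by [e] and [- e]. *)
Lemma positive_functional_integral F (v : expect R X) :
  positive_functional F ->
  (forall A : set X, F (fun x => (x \in A)%:R) = v A) ->
  forall f, bdd f -> F f = fa_integral v f.
Proof.
move=> pF Fv f bf; have [FD FZ Fle] := pF.
have F1 a : F (fun=> a) = a.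
  have -> : (fun _ : X => a) = (fun x => a * (x \in [set: X])%:R).
    by apply: funext => x; rewrite in_setT mulr1.
  by rewrite FZ ?Fv ?massT ?mulr1 //; exact: bdd_indic.
(* The factor 2 counts one error [e] for [F f] and one for the integral of [f], both measured from
   [ssum v p c]. *)
apply: (@eq_of_near _ _ _ 2) => // e e0.
have [n [p [c pc]]] := simple_approx bf e0.
have bc : bdd (fun x => c (p x)) by exact: bdd_fin.
have Fc : F (fun x => c (p x)) = ssum v p c.
  have -> : (fun x => c (p x))
      = (fun x => \sum_i c i * (x \in p @^-1` [set i])%:R).
    apply: funext => x; rewrite (bigD1 (p x)) //= big1 ?addr0.
      by rewrite mem_set ?mulr1.
    move=> i ip; rewrite memNset ?mulr0 // => xi.
    by rewrite xi eqxx in ip.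
  rewrite positive_functional_sum //; last by move=> i; apply/bddZ/bdd_indic.
  by apply: eq_bigr => i _; rewrite FZ ?Fv //; exact: bdd_indic.
have h := fa_integral_near v bf pc.
have le1 : F f <= F (fun x => c (p x) + e).
  apply: Fle => //; first by apply: bddD => //; exact: bdd_cst.
  by move=> x; have := pc x; rewrite ler_norml; lra.
have le2 : F (fun x => c (p x) + - e) <= F f.
  apply: Fle => //; first by apply: bddD => //; exact: bdd_cst.
  by move=> x; have := pc x; rewrite ler_norml; lra.
rewrite !FD // ?Fc ?F1 in le1 le2; try exact: bdd_cst.
by move: h; rewrite !ler_norml; lra.
Qed.

(** The measure of [A] is the value of [F] at the indicator of [A]. *)
Lemma positive_functional_repr F :
  positive_functional F -> F (fun=> 1) = 1 ->
  exists v : expect R X, forall f, bdd f -> fa_integral v f = F f.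
Proof.
move=> pF F1; have [FD FZ Fle] := pF.
have F0 : F (fun=> 0) = 0 by rewrite positive_functional_cst ?mul0r.
have v01 (A : set X) : 0 <= F (fun x => (x \in A)%:R) <= 1.
  by apply/andP; split; [rewrite -[leLHS]F0|rewrite -[leRHS]F1]; apply: Fle;
    try exact: bdd_cst; try exact: bdd_indic;
    move=> x; case: (x \in A); rewrite ?ler01 ?lexx.
have vT : F (fun x => (x \in [set: X])%:R) = 1.
  by rewrite -F1; congr F; apply: funext => x; rewrite in_setT.
have vU (A B : set X) : A `&` B = set0 -> F (fun x => (x \in A `|` B)%:R)
    = F (fun x => (x \in A)%:R) + F (fun x => (x \in B)%:R).
  move=> AB; rewrite -FD; try exact: bdd_indic.
  (* Pointwise additivity of indicators is additivity of the Dirac measure at [x]. *)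
  by congr F; apply: funext => x; exact: (massU (eeta R x) AB).
exists (Expect v01 vT vU) => f bf; apply/esym.
exact: positive_functional_integral.
Qed.

(** Dividing by the total mass [F 1] reduces the nonzero case to the normalised one. The dichotomy
    later decides in which summand of [star] a point lies. *)
Lemma positive_functional_scaled F : positive_functional F ->
  F (fun=> 1) = 0 \/
  0 < F (fun=> 1) /\ exists v : expect R X,
    forall f, bdd f -> F f = F (fun=> 1) * fa_integral v f.
Proof.
move=> pF; have [FD FZ Fle] := pF.
have F0 : F (fun=> 0) = 0 by rewrite positive_functional_cst ?mul0r.
have : 0 <= F (fun=> 1) by rewrite -{1}F0; apply: Fle => //; exact: bdd_cst.
rewrite le_eqVlt => /orP[/eqP <-|F1]; [by left|right; split => //].
have [|v vF] := @positive_functional_repr (fun f => F f / F (fun=> 1)) _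
  (divff (lt0r_neq0 F1)).
  split=> [f g bf bg|a f bf|f g bf bg fg].
  - by rewrite FD // mulrDl.
  - by rewrite FZ // mulrA.
  - by rewrite ler_pM2r ?invr_gt0 //; exact: Fle.
by exists v => f bf; rewrite vF // mulrC divfK // lt0r_neq0.
Qed.

(** [f] lies between two constants, and [F] vanishes on constants. *)
Lemma positive_functional_null F f : positive_functional F ->
  F (fun=> 1) = 0 -> bdd f -> F f = 0.
Proof.
move=> [FD FZ Fle] F1 bf; have [M fM] := bf.
have Fc a : F (fun=> a) = 0.
  by rewrite positive_functional_cst ?F1 ?mulr0 //; split.
by apply/le_anti/andP; split; rewrite -?[leRHS](Fc M) -?[leLHS](Fc (- M));
  apply: Fle => //; try exact: bdd_cst;
  move=> x; have := fM x; rewrite ler_norml => /andP[].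
Qed.

Lemma expect_eq_integral (v w : expect R X) :
  (forall f, bdd f -> fa_integral v f = fa_integral w f) -> v = w.
Proof.
move=> vw; apply: expect_eq => A.
by rewrite -!fa_integral_indic; apply/vw/bdd_indic.
Qed.
End Representation.

(** * Separating points of a convex tensor by convex combinations of functions *)

Section Mix.
Context (R : realType).

Definition mix A B (f : A -> R) (g : B -> R) (t : star R A B) : R :=
  match t with
  | inl (inl a) => f a
  | inl (inr (r, a, b)) => oval r * f a + (1 - oval r) * g b
  | inr b => g b
  end.

Lemma mix_map A A' B B' (a : A -> A') (b : B -> B') f g (t : star R A B) :
  mix f g (star_map a b t) = mix (fun x => f (a x)) (fun y => g (b y)) t.
Proof. by case: t => [[x|[[r x] y]]|y]. Qed.

Lemma mix_swap A B (f : A -> R) (g : B -> R) t :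
  mix g f (star_swap t) = mix f g t.
Proof. by case: t => [[x|[[r x] y]]|y] //=; ring. Qed.

(** On the innermost summand both sides are the combination with weights [r * s], [r * (1 - s)] and
    [1 - r], which is what the quotient in the associator is designed for. *)
Lemma mix_assoc A B C (f : A -> R) (g : B -> R) (h : C -> R) t :
  mix f (mix g h) (star_assoc t) = mix (mix f g) h t.
Proof.
case: t => [[[[a|[[s a] b]]|b]|[[r [[a|[[s a] b]]|b]] c]]|c] //=.
(* The only denominator is [1 - r * s]. *)
have := ounit_lt1 (omul r s); rewrite /= => rs.
by field; lra.
Qed.

Lemma mix_add A B (f f' : A -> R) (g g' : B -> R) t :
  mix (fun x => f x + f' x) (fun y => g y + g' y) t = mix f g t + mix f' g' t.
Proof. by case: t => [[x|[[r x] y]]|y] //=; ring. Qed.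

Lemma mix_scale A B a (f : A -> R) (g : B -> R) t :
  mix (fun x => a * f x) (fun y => a * g y) t = a * mix f g t.
Proof. by case: t => [[x|[[r x] y]]|y] //=; ring. Qed.

Lemma mix_cst A B a (t : star R A B) : mix (fun=> a) (fun=> a) t = a.
Proof. by case: t => [[x|[[r x] y]]|y] //=; ring. Qed.

Lemma mix_le A B (f f' : A -> R) (g g' : B -> R) t :
  (forall x, f x <= f' x) -> (forall y, g y <= g' y) ->
  mix f g t <= mix f' g' t.
Proof.
move=> ff gg; case: t => [[x|[[r x] y]]|y] //=.
have := ounit_gt0 r; have := ounit_lt1 r => r1 r0.
by apply: lerD; rewrite ler_wpM2l ?ff ?gg //; lra.
Qed.

Lemma bdd_mix A B (f : A -> R) (g : B -> R) : bdd f -> bdd g -> bdd (mix f g).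
Proof.
move=> [M fM] [N gN]; pose K := Num.max M N; exists K => t.
have fK x : - K <= f x <= K by rewrite -ler_norml le_max fM.
have gK y : - K <= g y <= K by rewrite -ler_norml le_max gN orbT.
rewrite ler_norml; apply/andP.
split; [rewrite -[leLHS](mix_cst _ t)|rewrite -[leRHS](mix_cst _ t)];
  apply: mix_le => z;
  first [by have /andP[] := fK z|by have /andP[] := gK z].
Qed.

(** The constants 0 and 1 make the property pass to [star]: the pair (1, 0) measures the weight,
    while a zero in one slot isolates the other. Being closed under [star], it iterates to three
    factors. *)
Definition separating A (S : set (A -> R)) : Prop :=
  [/\ S (fun=> 0), S (fun=> 1) &
      forall x y, (forall f, S f -> f x = f y) -> x = y].

Definition mixes A B (S : set (A -> R)) (T : set (B -> R)) :
    set (star R A B -> R) :=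
  [set h | exists f g, [/\ S f, T g & h = mix f g]].

Lemma separating_mixes A B (S : set (A -> R)) (T : set (B -> R)) :
  separating S -> separating T -> separating (mixes S T).
Proof.
move=> [S0 S1 Sinj] [T0 T1 Tinj]; split.
- exists (fun=> 0), (fun=> 0); split => //.
  by apply: funext => t; rewrite mix_cst.
- exists (fun=> 1), (fun=> 1); split => //.
  by apply: funext => t; rewrite mix_cst.
move=> t u tu.
have {}tu f g : S f -> T g -> mix f g t = mix f g u.
  by move=> Sf Tg; apply: tu; exists f, g.
(* [mix 1 0] is the weight of the left factor: 1, [r] or 0 on the three summands. These ranges are
   disjoint, so all pairs from different summands are contradictory. *)
have w10 := tu _ _ S1 T0.
case: t u tu w10 => [[a|[[r a] b]]|b] [[a'|[[r' a'] b']]|b'] tu /= w10.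
all: try (by clear tu; exfalso; lra).
all: try (by clear tu; exfalso; move: w10 (ounit_gt0 r) (ounit_lt1 r); lra).
all: try (by clear tu; exfalso; move: w10 (ounit_gt0 r') (ounit_lt1 r'); lra).
- by congr (inl (inl _)); apply: Sinj => f Sf; exact: (tu f _ Sf T0).
- have {}w10 : oval r = oval r' by lra.
  have r0 := ounit_gt0 r; have r1 := ounit_lt1 r.
  apply: starM_eq => //.
    (* With zero on the right and equal weights, the test reads [r * f a = r * f a'], and [r]
       cancels. *)
    apply: Sinj => f Sf; have := tu f _ Sf T0; rewrite /= -w10 !mulr0 !addr0.
    by apply: mulfI; rewrite lt0r_neq0.
  apply: Tinj => g Tg; have := tu _ g S0 Tg; rewrite /= -w10 !mulr0 !add0r.
  by apply: mulfI; rewrite lt0r_neq0 // subr_gt0.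
- by congr inr; apply: Tinj => g Tg; exact: (tu _ g S0 Tg).
Qed.

Definition integrals X : set (expect R X -> R) :=
  [set h | exists f, bdd f /\ h = (fun w => fa_integral w f)].

Lemma separating_integrals X : separating (@integrals X).
Proof.
split.
- exists (fun=> 0); split; first exact: bdd_cst.
  by apply: funext => w; rewrite fa_integral_cst.
- exists (fun=> 1); split; first exact: bdd_cst.
  by apply: funext => w; rewrite fa_integral_cst.
move=> v w vw; apply: expect_eq_integral => f bf.
by apply: (vw (fun u => fa_integral u f)); exists f.
Qed.

Lemma bdd_fa_integral X (f : X -> R) :
  bdd f -> bdd (fun w : expect R X => fa_integral w f).
Proof. by move=> [M fM]; exists M => w; exact: fa_integral_norm. Qed.

Lemma integral_emapE X Y (h : X -> Y) (f : Y -> R) : bdd f ->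
  (fun w => fa_integral (emap h w) f)
  = (fun w => fa_integral w (fun x => f (h x))).
Proof. by move=> bf; apply: funext => w; exact: fa_integral_emap. Qed.

Lemma integral_eetaE X (f : X -> R) : bdd f ->
  (fun x => fa_integral (eeta R x) f) = f.
Proof. by move=> bf; apply: funext => x; exact: fa_integral_eeta. Qed.

Lemma integral_emuE X (f : X -> R) : bdd f ->
  (fun W => fa_integral (emu W) f)
  = (fun W => fa_integral W (fun t => fa_integral t f)).
Proof. by move=> bf; apply: funext => W; exact: fa_integral_emu. Qed.

Lemma star_expect_eq X Y (t u : star R (expect R X) (expect R Y)) :
  (forall f g, bdd f -> bdd g ->
    mix (fun w => fa_integral w f) (fun w => fa_integral w g) t
    = mix (fun w => fa_integral w f) (fun w => fa_integral w g) u) -> t = u.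
Proof.
move=> tu; have [_ _ inj] :=
  separating_mixes (@separating_integrals X) (@separating_integrals Y).
apply: inj => h [f [g [[f' [bf' ->]] [g' [bg' ->]] ->]]]; exact: tu.
Qed.

Lemma star_expect3_eq X Y Z
    (t u : star R (expect R X) (star R (expect R Y) (expect R Z))) :
  (forall f g h, bdd f -> bdd g -> bdd h ->
    mix (fun w => fa_integral w f)
      (mix (fun w => fa_integral w g) (fun w => fa_integral w h)) t
    = mix (fun w => fa_integral w f)
      (mix (fun w => fa_integral w g) (fun w => fa_integral w h)) u) -> t = u.
Proof.
move=> tu; have [_ _ inj] := separating_mixes (@separating_integrals X)
  (separating_mixes (@separating_integrals Y) (@separating_integrals Z)).
apply: inj => _ [_ [_ [[f [bf ->]] [_ [_ [[g [bg ->]] [h [bh ->]] ->]]] ->]]].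
exact: tu.
Qed.
End Mix.

(** * The opmonoidal structure of the expectation monad *)

Section Opmonoidal.
Context (R : realType).

Lemma mix_integral_splits X Y (w : expect R (star R X Y)) :
  exists t : star R (expect R X) (expect R Y), forall f g, bdd f -> bdd g ->
    mix (fun v => fa_integral v f) (fun v => fa_integral v g) t
    = fa_integral w (mix f g).
Proof.
have b0 Z : bdd (fun _ : Z => 0 : R) by exact: bdd_cst.
have b1 Z : bdd (fun _ : Z => 1 : R) by exact: bdd_cst.
pose F (f : X -> R) := fa_integral w (mix f (fun=> 0)).
pose G (g : Y -> R) := fa_integral w (mix (fun=> 0) g).
have pF : positive_functional F.
  split=> [f f' bf bf'|a f bf|f f' bf bf' ff'].
  - rewrite /F -fa_integralD; try exact: bdd_mix.
    congr fa_integral; apply: funext => t; rewrite -mix_add; congr mix.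
    by apply: funext => y; rewrite addr0.
  - rewrite /F -fa_integralZ; try exact: bdd_mix.
    congr fa_integral; apply: funext => t; rewrite -mix_scale; congr mix.
    by apply: funext => y; rewrite mulr0.
  - apply: fa_integral_mono; try exact: bdd_mix.
    by move=> t; apply: mix_le.
have pG : positive_functional G.
  split=> [g g' bg bg'|a g bg|g g' bg bg' gg'].
  - rewrite /G -fa_integralD; try exact: bdd_mix.
    congr fa_integral; apply: funext => t; rewrite -mix_add; congr mix.
    by apply: funext => y; rewrite addr0.
  - rewrite /G -fa_integralZ; try exact: bdd_mix.
    congr fa_integral; apply: funext => t; rewrite -mix_scale; congr mix.
    by apply: funext => y; rewrite mulr0.
  - apply: fa_integral_mono; try exact: bdd_mix.
    by move=> t; apply: mix_le.
have FG f g : bdd f -> bdd g -> fa_integral w (mix f g) = F f + G g.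
  move=> bf bg; rewrite /F /G -fa_integralD; try exact: bdd_mix.
  congr fa_integral; apply: funext => t; rewrite -mix_add.
  by congr mix; apply: funext => z; rewrite ?addr0 ?add0r.
(* The total masses of [F] and [G] are complementary weights. *)
have FG1 : F (fun=> 1) + G (fun=> 1) = 1.
  rewrite -FG // -[RHS](fa_integral_cst w 1).
  by congr fa_integral; apply: funext => t; rewrite mix_cst.
(* Both masses cannot vanish. If one does, the point lies in an outer summand; otherwise [F 1] is
   the weight in the middle one. *)
have [F0|[F0 [u uF]]] := positive_functional_scaled pF;
have [G0|[G0 [v vG]]] := positive_functional_scaled pG.
- by exfalso; lra.
- exists (starR R _ v) => f g bf bg /=.
  have G1 : G (fun=> 1) = 1 by rewrite F0 add0r in FG1.
  by rewrite FG // (positive_functional_null pF) // vG // G1 add0r mul1r.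
- exists (starL R _ u) => f g bf bg /=.
  have F1 : F (fun=> 1) = 1 by rewrite G0 addr0 in FG1.
  by rewrite FG // (positive_functional_null pG) // uF // F1 addr0 mul1r.
have r01 : 0 < F (fun=> 1) < 1 by rewrite F0 -[ltRHS]FG1 ltrDl.
exists (starM (OUnit r01) u v) => f g bf bg /=.
have <- : G (fun=> 1) = 1 - F (fun=> 1).
  by apply/eqP; rewrite eq_sym subr_eq addrC FG1.
by rewrite FG // (uF f) // (vG g).
Qed.

Definition esplit X Y (w : expect R (star R X Y)) :
    star R (expect R X) (expect R Y) :=
  projT1 (cid (mix_integral_splits w)).

Lemma mix_esplit X Y (w : expect R (star R X Y)) f g : bdd f -> bdd g ->
  mix (fun v => fa_integral v f) (fun v => fa_integral v g) (esplit w)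
  = fa_integral w (mix f g).
Proof. exact: (projT2 (cid (mix_integral_splits w))). Qed.

(** The empty set would have mass both 0 and 1. *)
Lemma expect_void_false (w : expect R void) : False.
Proof.
have := massT w; rewrite (_ : setT = set0) ?mass0; last by apply/seteqP; split.
by move=> /esym/eqP; rewrite oner_eq0.
Qed.

Definition expect_void (w : expect R void) : void :=
  match expect_void_false w with end.

Lemma esplit_map X X' Y Y' (h : X -> X') (k : Y -> Y') w :
  esplit (emap (star_map h k) w) = star_map (emap h) (emap k) (esplit w).
Proof.
apply: star_expect_eq => f g bf bg.
have [bfh bgk] := (bdd_comp h bf, bdd_comp k bg).
rewrite mix_map (integral_emapE h bf) (integral_emapE k bg).
rewrite (mix_esplit _ bf bg) (mix_esplit _ bfh bgk).
rewrite (fa_integral_emap _ _ (bdd_mix bf bg)).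
by congr fa_integral; apply: funext => t; rewrite mix_map.
Qed.

(** Tested against [f], [g], [h], both sides become the integral of [mix (mix f g) h] against
    [w]. *)
Lemma esplit_assoc X Y Z (w : expect R (star R (star R X Y) Z)) :
  star_assoc (star_map (@esplit X Y) id (esplit w))
  = star_map id (@esplit Y Z) (esplit (emap (@star_assoc R X Y Z) w)).
Proof.
apply: star_expect3_eq => f g h bf bg bh.
rewrite mix_assoc !mix_map.
rewrite (_ : (fun x => mix _ _ (esplit x)) = fun x => fa_integral x (mix f g));
  last by apply: funext => x; rewrite mix_esplit.
rewrite (_ : (fun x => mix _ _ (esplit x)) = fun x => fa_integral x (mix g h));
  last by apply: funext => x; rewrite mix_esplit.
rewrite !mix_esplit ?fa_integral_emap //; try by do ?apply: bdd_mix.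
by congr fa_integral; apply: funext => t; rewrite mix_assoc.
Qed.

Lemma esplit_lunit X (w : expect R (star R void X)) :
  star_lunit (star_map expect_void id (esplit w)) = emap (@star_lunit R X) w.
Proof.
apply: expect_eq_integral => f bf; rewrite fa_integral_emap //.
(* Only the right summand is inhabited, so any function may be put on [void]; 0 is chosen because it
   is also an integral, as [mix_esplit] requires. *)
have mix0 Z (h : Z -> R) t : h (star_lunit t) = mix (fun=> 0) h t.
  by case: t => [[[]|[[r []] y]]|y].
rewrite (mix0 _ (fun v => fa_integral v f)) mix_map.
rewrite (_ : (fun=> 0) = (fun v => fa_integral v (fun=> 0))).
  rewrite mix_esplit //; last exact: bdd_cst.
  by congr fa_integral; apply: funext => t; rewrite mix0.
by apply: funext => v; rewrite fa_integral_cst.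
Qed.

Lemma esplit_runit X (w : expect R (star R X void)) :
  star_runit (star_map id expect_void (esplit w)) = emap (@star_runit R X) w.
Proof.
apply: expect_eq_integral => f bf; rewrite fa_integral_emap //.
have mix0 Z (h : Z -> R) t : h (star_runit t) = mix h (fun=> 0) t.
  by case: t => [[x|[[r x] []]]|[]].
rewrite (mix0 _ (fun v => fa_integral v f)) mix_map.
rewrite (_ : (fun=> 0) = (fun v => fa_integral v (fun=> 0))).
  rewrite mix_esplit //; last exact: bdd_cst.
  by congr fa_integral; apply: funext => t; rewrite mix0.
by apply: funext => v; rewrite fa_integral_cst.
Qed.

Lemma esplit_swap X Y (w : expect R (star R X Y)) :
  star_swap (esplit w) = esplit (emap (@star_swap R X Y) w).
Proof.
apply: star_expect_eq => f g bf bg.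
rewrite mix_swap !mix_esplit // fa_integral_emap; last exact: bdd_mix.
by congr fa_integral; apply: funext => t; rewrite mix_swap.
Qed.

Lemma esplit_eeta X Y (t : star R X Y) :
  esplit (eeta R t) = star_map (@eeta R X) (@eeta R Y) t.
Proof.
apply: star_expect_eq => f g bf bg.
by rewrite mix_esplit // mix_map !integral_eetaE // fa_integral_eeta //;
  exact: bdd_mix.
Qed.

(** Tested against [f] and [g], both sides become the iterated integral of [mix f g] against [W]. *)
Lemma esplit_emu X Y (W : expect R (expect R (star R X Y))) :
  esplit (emu W)
  = star_map (@emu R X) (@emu R Y) (esplit (emap (@esplit X Y) W)).
Proof.
apply: star_expect_eq => f g bf bg.
have bI := bdd_mix (bdd_fa_integral bf) (bdd_fa_integral bg).
rewrite mix_esplit // mix_map !integral_emuE // mix_esplit;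
  try exact: bdd_fa_integral.
rewrite fa_integral_emu ?fa_integral_emap //; last exact: bdd_mix.
by congr fa_integral; apply: funext => t; rewrite mix_esplit.
Qed.

Program Definition expectation_opmonoidal :
    @sym_opmonoidal (convex_smc R) (expectation_monad R) :=
  @SymOpmonoidal (convex_smc R) (expectation_monad R) expect_void esplit
    _ _ _ _ _ _ _ _ _.
Next Obligation. by apply: funext => w; exact: esplit_map. Qed.
Next Obligation. by apply: funext => w; exact: esplit_assoc. Qed.
Next Obligation. by apply: funext => w; exact: esplit_lunit. Qed.
Next Obligation. by apply: funext => w; exact: esplit_runit. Qed.
Next Obligation. by apply: funext => w; exact: esplit_swap. Qed.
Next Obligation. by apply: funext => t; exact: esplit_eeta. Qed.
Next Obligation. by apply: funext => -[]. Qed.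
Next Obligation. by apply: funext => W; exact: esplit_emu. Qed.
Next Obligation. by apply: funext => W; case: (expect_void (emu W)). Qed.
End Opmonoidal.

(** * The lifted tensor as coproduct of algebras *)

Section Coproduct.
Context (R : realType).

(** On the middle summand this is the two-point measure with weight [r] at [f x] and [1 - r] at
    [g y]; on the outer ones it is a Dirac measure. *)
Lemma combination_exists X Y Z (f : X -> Z) (g : Y -> Z) (t : star R X Y) :
  exists v : expect R Z, forall h, bdd h ->
    fa_integral v h = mix (fun x => h (f x)) (fun y => h (g y)) t.
Proof.
apply: (@positive_functional_repr R Z
  (fun h => mix (fun x => h (f x)) (fun y => h (g y)) t)); last exact: mix_cst.
split=> [h k _ _|a h _|h k _ _ hk]; [exact: mix_add|exact: mix_scale|].
exact: mix_le.
Qed.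

Definition combination X Y Z (f : X -> Z) (g : Y -> Z) (t : star R X Y) :
  expect R Z := projT1 (cid (combination_exists f g t)).

Lemma integral_combination X Y Z (f : X -> Z) (g : Y -> Z) t h : bdd h ->
  fa_integral (combination f g t) h
  = mix (fun x => h (f x)) (fun y => h (g y)) t.
Proof. exact: (projT2 (cid (combination_exists f g t))). Qed.

Lemma combinationL X Y Z (f : X -> Z) (g : Y -> Z) x :
  combination f g (starL R Y x) = eeta R (f x).
Proof.
apply: expect_eq_integral => h bh.
by rewrite integral_combination // fa_integral_eeta.
Qed.

Lemma combinationR X Y Z (f : X -> Z) (g : Y -> Z) y :
  combination f g (starR R X y) = eeta R (g y).
Proof.
apply: expect_eq_integral => h bh.
by rewrite integral_combination // fa_integral_eeta.
Qed.

Lemma combination_map X X' Y Y' Z (a : X -> X') (b : Y -> Y')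
    (f : X' -> Z) (g : Y' -> Z) t :
  combination f g (star_map a b t)
  = combination (fun x => f (a x)) (fun y => g (b y)) t.
Proof.
by apply: expect_eq_integral => h bh; rewrite !integral_combination // mix_map.
Qed.

Lemma emap_combination X Y Z Z' (k : Z -> Z') (f : X -> Z) (g : Y -> Z) t :
  emap k (combination f g t)
  = combination (fun x => k (f x)) (fun y => k (g y)) t.
Proof.
apply: expect_eq_integral => h bh.
rewrite fa_integral_emap // !integral_combination //; exact: bdd_comp.
Qed.

(** Both sides integrate [h] to the integral of [mix (h f) (h g)] against [w]. This compatibility of
    [esplit] with combinations makes copairings homomorphisms. *)
Lemma emu_combination X Y Z (f : X -> Z) (g : Y -> Z) w :
  emu (combination (emap f) (emap g) (esplit w))
  = emu (emap (combination f g) w).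
Proof.
apply: expect_eq_integral => h bh; have bI := bdd_fa_integral bh.
rewrite !fa_integral_emu // integral_combination // fa_integral_emap //.
have [bhf bhg] := (bdd_comp f bh, bdd_comp g bh).
rewrite (integral_emapE f bh) (integral_emapE g bh) (mix_esplit _ bhf bhg).
by congr fa_integral; apply: funext => t; rewrite integral_combination.
Qed.

Lemma esplit_combination X Y (t : star R X Y) :
  esplit (combination (@starL R X Y) (@starR R X Y) t)
  = star_map (@eeta R X) (@eeta R Y) t.
Proof.
apply: star_expect_eq => f g bf bg.
by rewrite mix_esplit // integral_combination ?mix_map ?integral_eetaE //;
  exact: bdd_mix.
Qed.

Notation U := (expectation_opmonoidal R).
Implicit Types A B C : algebra (expectation_monad R).

Lemma act_eeta A x : act A (eeta R x) = x.
Proof. exact: (congr1 (@^~ x) (act_eta A)). Qed.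

Lemma act_emu A W : act A (emu W) = act A (emap (act A) W).
Proof. exact: (congr1 (@^~ W) (act_mu A)). Qed.

Lemma alg_fun_act A B (f : alg_hom A B) w :
  alg_fun f (act A w) = act B (emap (alg_fun f) w).
Proof. exact: (congr1 (@^~ w) (alg_funP f)). Qed.

Definition copair A B C (f : alg_hom A C) (g : alg_hom B C)
  (t : star R (carrier A) (carrier B)) : carrier C :=
  act C (combination (alg_fun f) (alg_fun g) t).

(** Since [f] and [g] are homomorphisms, [act C] can be pulled out of the combination. The
    multiplication law of [C] turns it into [emu], where [emu_combination] applies, and the same law
    is then used backwards. *)
Lemma copair_act A B C (f : alg_hom A C) (g : alg_hom B C) w :
  copair f g (act (alg_tens U A B) w)
  = act C (emap (copair f g) w).
Proof.
rewrite /= /copair combination_map.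
rewrite (_ : (fun x => alg_fun f _) = fun u => act C (emap (alg_fun f) u));
  last by apply: funext => u; exact: alg_fun_act.
rewrite (_ : (fun x => alg_fun g _) = fun u => act C (emap (alg_fun g) u));
  last by apply: funext => u; exact: alg_fun_act.
rewrite -(emap_combination (act C) (emap (alg_fun f)) (emap (alg_fun g))).
rewrite -act_emu emu_combination act_emu.
by congr (act C _); exact: expect_eq.
Qed.

Definition copair_hom A B C (f : alg_hom A C) (g : alg_hom B C) :
    alg_hom (alg_tens U A B) C :=
  @AlgHom _ _ (alg_tens U A B) C (copair f g)
    (funext (fun w => copair_act f g w)).

(** [esplit] turns the formal combination of the injections into Dirac measures at the components of
    [t], which the unit laws of [A] and [B] evaluate back. *)
Lemma act_combination A B t :
  act (alg_tens U A B) (combination (@starL R _ _) (@starR R _ _) t) = t.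
Proof.
rewrite /= esplit_combination.
by case: t => [[a|[[r a] b]]|b] /=; rewrite ?act_eeta.
Qed.

(** A homomorphism carries the formal combination defining [t] to that of its values on the two
    injections. *)
Lemma copair_unique A B C (f : alg_hom A C) (g : alg_hom B C)
    (h : alg_hom (alg_tens U A B) C) :
  (forall a, alg_fun h (starL R _ a) = alg_fun f a) ->
  (forall b, alg_fun h (starR R _ b) = alg_fun g b) ->
  alg_fun h = copair f g.
Proof.
move=> /funext hf /funext hg; apply: funext => t.
by rewrite -{1}(act_combination t) alg_fun_act emap_combination hf hg.
Qed.

Lemma alg_unit_initial :
  is_initial (alg_unit U : Defs.EM (expectation_monad R)).
Proof.
move=> A; pose f0 (e : void) : carrier A := match e with end.
have f0P w : f0 (expect_void w) = act A (emap f0 w) by case: (expect_void w).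
exists (@AlgHom _ _ (alg_unit U) A f0 (funext f0P)); split => // f _.
by apply: alg_hom_eq; apply: funext => -[].
Qed.

End Coproduct.

Theorem proposition33 (R : realType) :
  exists U : @sym_opmonoidal (convex_smc R) (expectation_monad R),
    linear_exponential U.
Proof.
exists (expectation_opmonoidal R), (@alg_unit_initial R) => X Y Z f g.
exists (copair_hom f g); split.
  (* Tensoring with a map out of [void] acts trivially on the outer summand in question, so the
     coprojections compute to [starL] and [starR]. *)
  split; apply: alg_hom_eq; apply: funext => x /=.
    by rewrite /copair combinationL act_eeta.
  by rewrite /copair combinationR act_eeta.
move=> h [<- <-]; apply: alg_hom_eq; apply/esym.
by apply: copair_unique.
Qed.
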